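(* Consider an instance of the energy-constrained scheduling problem with zero communication delays (defined in the context) with $n$ tasks and $m \ge n$ processors. For every real number $\mu \ge 0$, there exist real numbers $t_j, d_j$ ($j \in J$) such that $(\mu, (t_j), (d_j))$ is a feasible solution of the program $P_1$ if and only if there exists a feasible schedule on the $m$ processors with makespan $\mu$.
   Context: Problem (zero communication delays): we are given a finite set $J$ of $n$ tasks; $m$ identical processors; a directed acyclic graph $G$ on vertex set $J$ (an edge $i \to j$ means task $i$ must finish before task $j$ begins); for each task $j$ a convex, non-increasing energy function $e_j : [0,\infty) \to [0,\infty)$, where $e_j(d_j)$ is the energy consumed when $j$ runs for a total time $d_j$; and an energy bound $E \ge 0$. A schedule assigns to each task $j$ a finite set of time intervals, each on some processor (preemption and migration are allowed; no task is computed more than once). $d_j$ denotes the total length of the intervals assigned to $j$ and $t_j$ its start time (the earliest left endpoint of its intervals). The schedule is feasible if (a) for every edge $i \to j$ of $G$, task $i$ has finished (all its intervals have ended) by the time $j$ begins; (b) each processor works on at most one task at any time; and (c) $\sum_j e_j(d_j) \le E$. The makespan is the time at which the last task completes. Program $P_1$ (for given $m$): minimize $\mu$ over variables $\mu \ge 0$, $t_j \ge 0$, $d_j \ge 0$ ($j\in J$) subject to: $t_j \ge t_i + d_i$ for every edge $i \to j$; $\mu \ge t_j + d_j$ for all $j$; $\sum_j e_j(d_j) \le E$; $\mu \ge \frac{1}{m}\sum_j d_j$. *)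

(* Defs.v *)
From HB Require Import structures.
From mathcomp Require Import all_boot all_order all_algebra finmap.
From mathcomp Require Import all_classical all_reals all_analysis.

Set Implicit Arguments.
Unset Strict Implicit.
Unset Printing Implicit Defensive.

Import Order.TTheory GRing.Theory Num.Theory.

Local Open Scope classical_set_scope.
Local Open Scope ring_scope.

Definition acyclic (J : finType) (G : rel J) : Prop :=
  forall c : seq J, cycle G c -> c = [::].

(* A function [0, +oo) -> [0, +oo) is represented by a total function on R
   that is only constrained (and only ever evaluated) on [0, +oo). *)
Record energy_function (R : realType) (f : R -> R) : Prop := EnergyFunction {
  energy_ge0 : forall x, 0 <= x -> 0 <= f x;
  energy_convex : @convex_function R R^o `[0, +oo[ f;
  energy_noninc : forall x y, 0 <= x -> x <= y -> f y <= f x }.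

Section Schedules.
Variables (R : realType) (J : finType) (m : nat).

(* ((a, b), p): the time interval from a to b on processor p. *)
Definition slot : Type := (R * R * 'I_m)%type.
Definition left_end (I : slot) : R := I.1.1.
Definition right_end (I : slot) : R := I.1.2.
Definition proc (I : slot) : 'I_m := I.2.

(* Half-open, so that abutting intervals do not conflict and an interval of
   length 0, which a task of duration 0 needs, occupies no processor time. *)
Definition busy (I : slot) (x : R) : Prop := left_end I <= x < right_end I.

Definition schedule : Type := J -> {fset (R * R * 'I_m)}.

Implicit Types (S : schedule) (j : J).

Definition duration S j : R := \sum_(I <- S j) (right_end I - left_end I).

(* S j is finite and nonempty in a schedule, so inf and sup below are a
   minimum and a maximum. *)
Definition start S j : R := inf [set left_end I | I in [set` S j]].
Definition finish S j : R := sup [set right_end I | I in [set` S j]].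
Definition makespan S : R := sup [set finish S j | j in [set: J]].

(* no_recomputation: a task may be preempted and migrated, but it is never
   executed twice at the same time (in particular not on two processors). *)
Record is_schedule S : Prop := IsSchedule {
  slots_neq0 : forall j, S j != fset0;
  slots_wf : forall j I, I \in S j -> 0 <= left_end I <= right_end I;
  no_recomputation : forall j I I' x, I \in S j -> I' \in S j ->
    busy I x -> busy I' x -> I = I' }.

Record feasible_schedule (G : rel J) (e : J -> R -> R) (E : R) S : Prop :=
  FeasibleSchedule {
    feasible_is_schedule : is_schedule S;
    feasible_precedence : forall i j, G i j -> finish S i <= start S j;
    feasible_processors : forall i j I I' x, I \in S i -> I' \in S j ->
      proc I = proc I' -> busy I x -> busy I' x -> i = j;
    feasible_energy : \sum_(j : J) e j (duration S j) <= E }.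

End Schedules.

Record P1_feasible (R : realType) (J : finType) (m : nat) (G : rel J)
    (e : J -> R -> R) (E mu : R) (t d : J -> R) : Prop := P1Feasible {
  P1_mu_ge0 : 0 <= mu;
  P1_t_ge0 : forall j, 0 <= t j;
  P1_d_ge0 : forall j, 0 <= d j;
  P1_precedence : forall i j, G i j -> t i + d i <= t j;
  P1_makespan : forall j, t j + d j <= mu;
  P1_energy : \sum_(j : J) e j (d j) <= E;
  P1_load : m%:R^-1 * (\sum_(j : J) d j) <= mu }.

(* Main.v *)
(** With at least as many processors as tasks, every task can have a processor
of its own, so a solution of P1 is turned into a schedule by running task j
without interruption on [t j, t j + d j).  Its makespan may fall short of mu;
a task without successors, which exists by acyclicity, is then prolonged until
time mu, which does not increase the energy.  Conversely, the start times and
durations of a schedule solve P1: the slots of a task are disjoint, hence its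
duration is at most its finish time minus its start time. *)
Require Import Defs.
From HB Require Import structures.
From mathcomp Require Import all_boot all_order all_algebra finmap.
From mathcomp Require Import all_classical all_reals all_analysis.
From mathcomp Require Import lra.

Set Implicit Arguments.
Unset Strict Implicit.
Unset Printing Implicit Defensive.

Import Order.TTheory GRing.Theory Num.Theory.

Local Open Scope classical_set_scope.
Local Open Scope ring_scope.

(** If every vertex had a successor, iterating a successor function [f] on the finite type [J] would
    revisit a vertex and so close a nonempty cycle of [G]. *)
Lemma acyclic_sink (J : finType) (G : rel J) :
  (0 < #|J|)%N -> acyclic G -> exists k, forall j, ~~ G k j.
Proof.
move=> /card_gt0P[x0 _] acG; apply: contrapT => nosink.
have succ k : exists j, G k j.
  apply: contrapT => noj; apply: nosink; exists k => j.
  by apply/negP => Gkj; apply: noj; exists j.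
have [f Gf] := choice succ.
(* The orbit of [x0] comes back to its [i]-th point, so [y] returns to itself after [p] steps. *)
have /trajectP[i lt_i_n eq_iter] := looping_order f x0.
set y := iter i f x0; set p := (order f x0 - i)%N in lt_i_n eq_iter *.
have p_gt0 : (0 < p)%N by rewrite subn_gt0.
have cyc : iter p f y = y.
  by rewrite -iterD subnK ?(ltnW lt_i_n).
suff /acG : cycle G (traject f y p) by case: p p_gt0 {cyc}.
case: p p_gt0 cyc => // q _ cyc /=.
have -> : rcons (traject f (f y) q) y = traject f (f y) q.+1.
  by rewrite trajectSr -iterSr cyc.
apply: sub_path (fpath_traject f y q.+1).
by move=> a b /eqP <-.
Qed.

Section FiniteSupInf.
Variables (R : realType) (T : eqType) (s : seq T) (F : T -> R).

Lemma le_sup_seq x : x \in s -> F x <= sup [set F i | i in [set` s]].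
Proof.
move=> xs; apply: ub_le_sup; last by exists x.
(* Only some upper bound is required, so the default value [0] of the maximum is harmless. *)
exists (\big[Order.max/0]_(i <- s) F i) => _ [i /= si <-].
exact: le_bigmax_seq.
Qed.

Lemma inf_le_seq x : x \in s -> inf [set F i | i in [set` s]] <= F x.
Proof.
move=> xs; apply: ge_inf; last by exists x.
exists (\big[Order.min/0]_(i <- s) F i) => _ [i /= si <-].
exact: ge_bigmin_seq.
Qed.

End FiniteSupInf.

Section DisjointIntervals.
Variables (R : realType) (T : eqType) (l r : T -> R) (a : R).

(* The interval I with the largest left end is taken out first: if its length is
   positive, then by disjointness the other ones are contained in [a, l I]. *)
Lemma sum_disjoint_intervals (s : seq T) (b : R) : uniq s -> a <= b ->
  (forall I, I \in s -> [/\ a <= l I, l I <= r I & r I <= b]) ->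
  (forall I I' x, I \in s -> I' \in s ->
    l I <= x < r I -> l I' <= x < r I' -> I = I') ->
  \sum_(I <- s) (r I - l I) <= b - a.
Proof.
pose e := [rel I I' | l I' <= l I].
have e_trans : transitive e by move=> y x z /= xy yz; exact: le_trans yz xy.
have e_total : total e by move=> x y; rewrite /= le_total.
move=> s_uniq ab s_in s_disj.
rewrite -(perm_big _ (permEl (perm_sort e s))) /=.
have : pairwise e (sort e s).
  by rewrite -(sorted_pairwise e_trans) sort_sorted.
have : uniq (sort e s) by rewrite sort_uniq.
have {s_in} : forall I, I \in sort e s -> [/\ a <= l I, l I <= r I & r I <= b].
  by move=> I; rewrite mem_sort; exact: s_in.
have {s_disj} : forall I I' x, I \in sort e s -> I' \in sort e s ->
    l I <= x < r I -> l I' <= x < r I' -> I = I'.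
  by move=> I I' x; rewrite !mem_sort; exact: s_disj.
(* The bound [b] is generalized because it drops to [l I] once the head [I] is removed. *)
elim: (sort e s) b ab {s_uniq} => [|I q IH] b ab q_disj q_in.
  by rewrite big_nil subr_ge0.
rewrite big_cons /= => /andP[Iq q_uniq] /andP[/allP I_max q_pw].
have [aI lrI rbI] := q_in I (mem_head _ _).
have q_disj' I1 I2 x : I1 \in q -> I2 \in q ->
    l I1 <= x < r I1 -> l I2 <= x < r I2 -> I1 = I2.
  by move=> q1 q2; apply: q_disj; rewrite inE ?q1 ?q2 orbT.
have q_in' I' : I' \in q -> [/\ a <= l I', l I' <= r I' & r I' <= b].
  by move=> qI'; apply: q_in; rewrite inE qI' orbT.
(* An interval of length 0 contains no point, so disjointness says nothing about it; it adds 0 to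
   the sum and [b] is kept. *)
have [lrI_eq|lrI_neq] := eqVneq (l I) (r I).
  by rewrite lrI_eq subrr add0r; exact: IH.
have {lrI lrI_neq} lrI : l I < r I by rewrite lt_neqAle lrI_neq.
suff : \sum_(j <- q) (r j - l j) <= l I - a by lra.
apply: IH => // I' qI'; have [al lr _] := q_in' _ qI'; split => //.
rewrite leNgt; apply/negP => lt_lI_r.
have /= lI'_le := I_max _ qI'.
(* Otherwise the point [l I] would lie in both intervals. *)
have eqI : I = I'.
  apply: (q_disj I I' (l I)); rewrite ?mem_head ?inE ?qI' ?orbT //.
  - by rewrite lexx.
  - by rewrite lI'_le.
by rewrite eqI qI' in Iq.
Qed.

End DisjointIntervals.

Section ScheduleBounds.
Variables (R : realType) (J : finType) (m : nat) (S : schedule R J m).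
Hypothesis S_sched : is_schedule S.

Lemma slot_ex j : exists I, I \in S j.
Proof. by have /fset0Pn := slots_neq0 S_sched j. Qed.

Lemma start_ge0 j : 0 <= start S j.
Proof.
have [I SI] := slot_ex j.
apply: lb_le_inf; first by exists (left_end I), I.
by move=> _ [I' /= SI' <-]; have /andP[] := slots_wf S_sched SI'.
Qed.

Lemma duration_ge0 j : 0 <= duration S j.
Proof.
rewrite /duration big_seq; apply: sumr_ge0 => I SI.
by rewrite subr_ge0; have /andP[] := slots_wf S_sched SI.
Qed.

Lemma start_duration_le_finish j : start S j + duration S j <= finish S j.
Proof.
rewrite addrC -lerBrDr; have slot_in I : I \in S j ->
    [/\ start S j <= left_end I, left_end I <= right_end I
      & right_end I <= finish S j].
  move=> SI; split; last exact: le_sup_seq.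
  - exact: inf_le_seq.
  - by have /andP[] := slots_wf S_sched SI.
apply: sum_disjoint_intervals => //.
- have [I /slot_in[sl lr rf]] := slot_ex j.
  exact: le_trans sl (le_trans lr rf).
- by move=> I I' x SI SI'; exact: (no_recomputation S_sched SI SI').
Qed.

Lemma finish_le_makespan j : finish S j <= makespan S.
Proof.
rewrite /makespan; have -> : [set: J] = [set` enum J].
  by apply/seteqP; split => i //= _; rewrite mem_enum.
by apply: le_sup_seq; rewrite mem_enum.
Qed.

End ScheduleBounds.

Section OneSlotSchedule.
Variables (R : realType) (J : finType) (m : nat).
Variables (t d : J -> R) (p : J -> 'I_m).

Definition one_slot : schedule R J m :=
  fun j => fset1 (t j, t j + d j, p j).

Lemma one_slotE j :
  [set` one_slot j] = [set (t j, t j + d j, p j)].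
Proof. by rewrite set_fset1. Qed.

Lemma start_one_slot j : start one_slot j = t j.
Proof. by rewrite /start one_slotE image_set1 inf1. Qed.

Lemma finish_one_slot j : finish one_slot j = t j + d j.
Proof. by rewrite /finish one_slotE image_set1 sup1. Qed.

Lemma duration_one_slot j : duration one_slot j = d j.
Proof.
by rewrite /duration big_seq_fset1 /left_end /right_end /= addrC addKr.
Qed.

(** Injectivity of [p] settles processor conflicts whatever the times are: slots on the same
    processor belong to the same task. *)
Lemma one_slot_feasible (G : rel J) (e : J -> R -> R) (E : R) :
  injective p -> (forall j, 0 <= t j) -> (forall j, 0 <= d j) ->
  (forall i j, G i j -> t i + d i <= t j) ->
  \sum_j e j (d j) <= E -> feasible_schedule G e E one_slot.
Proof.
move=> p_inj t_ge0 d_ge0 prec energy; split.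
- split.
  + by move=> j; apply/fset0Pn; exists (t j, t j + d j, p j); rewrite inE.
  + by move=> j I /fset1P ->; rewrite /left_end /right_end /= t_ge0 lerDl /=.
  + by move=> j I I' x /fset1P -> /fset1P ->.
- by move=> i j /prec; rewrite finish_one_slot start_one_slot.
- by move=> i j I I' x /fset1P -> /fset1P -> /p_inj.
- by under eq_bigr do rewrite duration_one_slot.
Qed.

Lemma makespan_one_slot (mu : R) k :
  (forall j, t j + d j <= mu) -> t k + d k = mu -> makespan one_slot = mu.
Proof.
move=> le_mu eq_mu; apply/eqP; rewrite eq_le; apply/andP; split.
- apply: ge_sup; first by exists (finish one_slot k), k.
  by move=> _ [j _ <-]; rewrite finish_one_slot.
- rewrite -{1}eq_mu -finish_one_slot; exact: finish_le_makespan.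
Qed.

End OneSlotSchedule.

Theorem theorem1 (R : realType) (J : finType) (m : nat) (G : rel J)
    (e : J -> R -> R) (E : R)
    (J_gt0 : (0 < #|J|)%N) (J_le_m : (#|J| <= m)%N)
    (G_acyclic : acyclic G)
    (e_energy : forall j, energy_function (e j))
    (E_ge0 : 0 <= E) (mu : R) (mu_ge0 : 0 <= mu) :
  (exists t d : J -> R, P1_feasible m G e E mu t d) <->
  (exists S : schedule R J m,
     feasible_schedule G e E S /\ makespan S = mu).
Proof.
split => [[t [d [_ t_ge0 d_ge0 prec le_mu energy _]]]|[S [S_feas S_mu]]].
- have [k k_sink] := acyclic_sink J_gt0 G_acyclic.
  pose d' j := if j == k then mu - t k else d j.
  pose p j := widen_ord J_le_m (enum_rank j).
  have p_inj : injective p.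
    by move=> i j /(congr1 val) /= /val_inj /enum_rank_inj.
  (* Durations only grow, since [t k + d k <= mu]; this keeps them nonnegative and, as each [e j] is
     non-increasing, within the energy bound. *)
  have d_le_d' j : d j <= d' j.
    by rewrite /d'; case: eqP => // ->; rewrite lerBrDl.
  exists (one_slot t d' p); split.
  + apply: one_slot_feasible => //.
    * by move=> j; exact: le_trans (d_ge0 j) (d_le_d' j).
    (* An edge constrains the duration of its source only, and the sink [k] is the source of
       none. *)
    * move=> i j Gij; rewrite /d'; case: eqP => [ik|_]; last exact: prec.
      by have := k_sink j; rewrite -ik Gij.
    * apply: le_trans energy; apply: ler_sum => j _.
      exact: (energy_noninc (e_energy j)).
  + apply: (@makespan_one_slot _ _ _ _ _ _ _ k).
    * by move=> j; rewrite /d'; case: eqP => [->|_] //; rewrite addrC subrK.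
    * by rewrite /d' eqxx addrC subrK.
- have S_sched := feasible_is_schedule S_feas.
  have end_le j : start S j + duration S j <= mu.
    rewrite -S_mu; apply: le_trans (finish_le_makespan S j).
    exact: start_duration_le_finish.
  exists (start S), (duration S); split => //.
  + exact: start_ge0.
  + exact: duration_ge0.
  + move=> i j Gij; apply: le_trans (feasible_precedence S_feas Gij).
    exact: start_duration_le_finish.
  + exact: feasible_energy S_feas.
  (* Start times are nonnegative, so each duration is at most [mu]; the total is then at most
     [#|J| * mu], hence at most [m * mu]. *)
  + have m_gt0 : 0 < m%:R :> R by rewrite ltr0n (leq_trans J_gt0).
    rewrite mulrC ler_pdivrMr //.
    have : \sum_j duration S j <= \sum_(j : J) mu.
      apply: ler_sum => j _; apply: le_trans (end_le j).
      by rewrite lerDr start_ge0.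
    move/le_trans; apply; rewrite sumr_const -[_ *+ _]mulr_natr.
    by rewrite ler_wpM2l // ler_nat.
Qed.
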